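(* Let $(Q,W)$ be the quiver with potential associated to a geometrically consistent brane tiling, $A=\mathbb{C}Q/(\partial W)$ and $\alpha=(1,\dots,1)\in\mathbb{Z}^{Q_0}$. Two indecomposable representations $x,y\in R(A,\alpha)$ are contained in the same $T_\Lambda$-orbit if and only if they have the same support.
   Context: Brane tilings. A brane tiling is a bipartite graph $G=(G_0^\pm,G_1)$ (white vertices $G_0^+$, black vertices $G_0^-$) embedded in the real two-dimensional torus $T$ so that all connected components of $T\setminus G$ are simply connected; the set of these faces is $G_2$. The dual quiver $Q=(Q_0,Q_1)$ has $Q_0=G_2$ and $Q_1=G_1$; the arrow $a$ joins the two faces of $G$ adjacent to the edge $a$ and is directed so that the white endpoint lies on the right of $a$. $Q$ is embedded in $T$ and its set of faces $Q_2$ is identified with $G_0$, $Q_2=Q_2^+\sqcup Q_2^-$. The arrows around every face $F\in Q_2$ form an oriented cycle $w_F$. Put $W=\sum_{F\in Q_2^+}w_F-\sum_{F\in Q_2^-}w_F$; for a cycle $u=a_1\cdots a_n$, $\partial u/\partial a=\sum_{i:\,a_i=a}a_{i+1}\cdots a_na_1\cdots a_{i-1}$; $(\partial W)$ is the two-sided ideal generated by all $\partial W/\partial a$, and $A=\mathbb{C}Q/(\partial W)$. Geometric consistency: there is a map $R:Q_1\to(0,1)$ with $\sum_{a\in F}R_a=2$ for all $F\in Q_2$ and $\sum_{a\ni i}(1-R_a)=2$ for all $i\in Q_0$ (sum over arrows incident to $i$, loops counted twice). $R(\mathbb{C}Q,\alpha)=\mathbb{C}^{Q_1}$ is the space of representations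 $x=(x_a)_{a\in Q_1}$ of $Q$ of dimension $\alpha$, and $R(A,\alpha)\subset R(\mathbb{C}Q,\alpha)$ is the closed subvariety of those satisfying the relations $\partial W/\partial a$, $a\in Q_1$. The support of $x$ is $\{a\in Q_1\mid x_a\ne0\}$. Let $d_2:\mathbb{Z}^{Q_2}\to\mathbb{Z}^{Q_1}$, $d_2(F)=\sum_{a\in F}a$, and $\Lambda=\mathbb{Z}^{Q_1}/\langle d_2(F)-d_2(F')\mid F,F'\in Q_2\rangle$. The group $T_\Lambda=\operatorname{Hom}_{\mathbb{Z}}(\Lambda,\mathbb{C}^* )$ is a subgroup of $\operatorname{Hom}_{\mathbb{Z}}(\mathbb{Z}^{Q_1},\mathbb{C}^* )=(\mathbb{C}^* )^{Q_1}$ and acts on $R(A,\alpha)$ by coordinatewise multiplication. *)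

(* Defs.v *)
From mathcomp Require Import all_boot all_order all_algebra fingroup perm.
From mathcomp Require Import reals complex.

Set Implicit Arguments.
Unset Strict Implicit.
Unset Printing Implicit Defensive.

Import GRing.Theory Num.Theory.
Local Open Scope ring_scope.
Local Open Scope complex_scope.

(** * Brane tilings

   A finite bipartite graph (multiple edges allowed) embedded in a closed
   oriented surface with simply connected faces is encoded, as usual, by its
   rotation system: [rotw] (resp. [rotb]) sends an edge to the next one in
   counterclockwise order around its white (resp. black) endpoint.  The surface
   is connected because the graph is, and it is a torus iff V - E + F = 0. *)

(* Walking along e from its black to its white endpoint with a face on the left,
   the next edges on the boundary of that face are rotw^-1 e (walked from white
   to black), then rotb^-1 (rotw^-1 e) (walked from black to white again).
   Perm products apply the left factor first. *)
Definition face_perm (E : finType) (rotw rotb : {perm E}) : {perm E} :=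
  (rotw^-1 * rotb^-1)%g.

Record brane_tiling := BraneTiling {
  white : finType;
  black : finType;
  edge : finType;
  wend : edge -> white;
  bend : edge -> black;
  rotw : {perm edge};
  rotb : {perm edge};
  rotwP : forall e f, (wend e == wend f) = (f \in porbit rotw e);
  rotbP : forall e f, (bend e == bend f) = (f \in porbit rotb e);
  wend_surj : forall v, exists e, wend e = v;
  bend_surj : forall v, exists e, bend e = v;
  edge_neq0 : (0 < #|edge|)%N;
  edge_connected : forall e f,
    connect (fun e1 e2 => (wend e1 == wend e2) || (bend e1 == bend e2)) e f;
  euler_torus :
    (#|white| + #|black| + #|porbits (face_perm rotw rotb)| = #|edge|)%N
}.

(* The faces (connected components of the complement of the graph): a face is
   the set of the edges e such that it lies on the left of e, when e is directed
   from black to white. *)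
Definition tface (G : brane_tiling) : finType :=
  {f : {set edge G} | f \in porbits (face_perm (rotw G) (rotb G))}.

Fact left_face_subproof (G : brane_tiling) (e : edge G) :
  porbit (face_perm (rotw G) (rotb G)) e
    \in porbits (face_perm (rotw G) (rotb G)).
Proof. exact: imset_f. Qed.

Definition left_face (G : brane_tiling) (e : edge G) : tface G :=
  exist (fun f : {set edge G} => f \in porbits (face_perm (rotw G) (rotb G))) _
    (left_face_subproof e).

Definition right_face (G : brane_tiling) (e : edge G) : tface G :=
  left_face ((rotb G)^-1%g e).

(** * Quivers with potential *)

Record quiver := Quiver {
  vertex : finType;
  arrow : finType;
  source : arrow -> vertex;
  target : arrow -> vertex
}.

(* Formal linear combinations of words in the arrows. *)
Definition combination (C : nzRingType) (Q : quiver) := seq (C * seq (arrow Q)).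

(* For u = a_1 ... a_n, the words a_(i+1) ... a_n a_1 ... a_(i-1) with a_i = a. *)
Definition cyclic_deriv_word (Q : quiver) (a : arrow Q) (u : seq (arrow Q)) :
    seq (seq (arrow Q)) :=
  [seq drop i.+1 u ++ take i u | i <- iota 0 (size u) & nth a u i == a].

Definition cyclic_deriv (C : nzRingType) (Q : quiver) (a : arrow Q)
    (W : combination C Q) : combination C Q :=
  flatten [seq [seq (cu.1, v) | v <- cyclic_deriv_word a cu.2] | cu <- W].

(** * Representations of dimension (1,...,1) *)

(* The space R(CQ,alpha) = C^{Q_1}. *)
Definition rep1 (C : nzRingType) (Q : quiver) := {ffun arrow Q -> C}.

Definition eval_rep1 (C : comNzRingType) (Q : quiver) (x : rep1 C Q)
    (p : combination C Q) : C :=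
  \sum_(cu <- p) cu.1 * \prod_(b <- cu.2) x b.

(* The subvariety R(A,alpha), where A = CQ/(dW). *)
Definition satisfies_relations (C : comNzRingType) (Q : quiver)
    (W : combination C Q) (x : rep1 C Q) : Prop :=
  forall a : arrow Q, eval_rep1 x (cyclic_deriv a W) = 0.

Definition rep_support (C : nzRingType) (Q : quiver) (x : rep1 C Q) :
    {set arrow Q} :=
  [set a | x a != 0].

Definition subrep (C : fieldType) (Q : quiver) (x : rep1 C Q)
    (U : vertex Q -> {vspace C^o}) : Prop :=
  forall (a : arrow Q) (u : C^o),
    u \in U (source a) -> x a *: u \in U (target a).

(* Nonzero, and not the direct sum of two nonzero subrepresentations. *)
Definition indecomposable (C : fieldType) (Q : quiver) (x : rep1 C Q) : Prop :=
  (0 < #|vertex Q|)%N /\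
  forall U V : vertex Q -> {vspace C^o},
    subrep x U -> subrep x V ->
    (forall i, (U i + V i)%VS = fullv /\ (U i :&: V i)%VS = 0%VS) ->
    (forall i, U i = 0%VS) \/ (forall i, V i = 0%VS).

(** * The quiver with potential of a brane tiling *)

(* An arrow a crosses the edge a with the white endpoint on its right. If a is
   drawn vertically with the white endpoint on top, the arrow points left. *)
Definition dual_quiver (G : brane_tiling) : quiver :=
  @Quiver (tface G) (edge G) (@right_face G) (@left_face G).

Definition qface (G : brane_tiling) : finType := (white G + black G)%type.

Definition on_qface (G : brane_tiling) (F : qface G) (a : edge G) : bool :=
  match F with
  | inl v => wend a == v
  | inr v => bend a == v
  end.

(* With the above orientation, the arrows turn clockwise around the white
   vertices and counterclockwise around the black ones. *)
Definition next_arrow (G : brane_tiling) (F : qface G) : {perm edge G} :=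
  match F with
  | inl _ => (rotw G)^-1%g
  | inr _ => rotb G
  end.

(* The cycle w_F, with an arbitrary starting arrow ([None] never occurs). *)
Definition face_cycle (G : brane_tiling) (F : qface G) : seq (edge G) :=
  if [pick a | on_qface F a] is Some a then orbit (next_arrow F) a else [::].

Definition potential (C : nzRingType) (G : brane_tiling) :
    combination C (dual_quiver G) :=
  [seq (1, face_cycle (inl v : qface G)) | v <- enum (white G)] ++
  [seq (-1, face_cycle (inr v : qface G)) | v <- enum (black G)].

(* The two sums in the last condition count loops twice. *)
Definition geometrically_consistent (R : realType) (G : brane_tiling) : Prop :=
  exists r : edge G -> R,
    [/\ forall a, 0 < r a < 1,
        forall F : qface G, \sum_(a | on_qface F a) r a = 2
      & forall i : vertex (dual_quiver G),
          \sum_(a : arrow (dual_quiver G) | source a == i) (1 - r a) +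
          \sum_(a : arrow (dual_quiver G) | target a == i) (1 - r a) = 2].

(** * The torus T_Lambda *)

Definition basis_vector (G : brane_tiling) (a : edge G) : {ffun edge G -> int} :=
  [ffun b => (b == a)%:R].

Definition d2 (G : brane_tiling) (F : qface G) : {ffun edge G -> int} :=
  \sum_(a | on_qface F a) basis_vector a.

(* The subgroup of Z^{Q_1} generated by the d2 F - d2 F'. *)
Definition Lambda_relation (G : brane_tiling) (u : {ffun edge G -> int}) : Prop :=
  exists c : qface G -> qface G -> int,
    u = \sum_F \sum_F' (d2 F - d2 F') *~ c F F'.

(* A homomorphism from Lambda to C^* is given as a homomorphism from Z^{Q_1} to
   C^* that is compatible with the congruence modulo the above subgroup. *)
Definition T_Lambda (C : fieldType) (G : brane_tiling)
    (t : {ffun edge G -> int} -> C) : Prop :=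
  [/\ forall u, t u != 0,
      forall u v, t (u + v) = t u * t v
    & forall u v, Lambda_relation (u - v) -> t u = t v].

Definition torus_act (C : fieldType) (G : brane_tiling)
    (t : {ffun edge G -> int} -> C) (x : rep1 C (dual_quiver G)) :
    rep1 C (dual_quiver G) :=
  [ffun a => t (basis_vector a) * x a].

Definition same_T_Lambda_orbit (C : fieldType) (G : brane_tiling)
    (x y : rep1 C (dual_quiver G)) : Prop :=
  exists t : {ffun edge G -> int} -> C, T_Lambda t /\ y = torus_act t x.

(* Main.v *)
(* Equal supports suffice because of the shape of the set Z of zero arrows, seen
   as edges of the bipartite graph.  The relations say that all the face products
   of x agree; so, unless Z is empty, they vanish, every vertex of the graph has
   an edge in Z, and an edge of Z is alone at its white end iff it is alone at its
   black end.  Indecomposability says that the complement of Z in the torus is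
   connected, and then at most one component of Z contains a cycle: two disjoint
   essential cycles would separate the torus.  Combinatorially, a ribbon graph
   with vertex rotations [sigma] and [t] and face permutation [t * sigma] has
   chi <= 0 on a part of minimal degree 2, and its number of boundary components
   is positive and congruent to chi modulo 2; two such parts contradict the
   Riemann-Hurwitz inequality.

   To extend z = y / x from the support to T_Lambda, choose values on Z for which
   all the face products are 1.  On an isolated edge of Z the two conditions
   agree, by the relation for this arrow; on the remaining component they can be
   met because the product of the required values, inverted at black vertices, is
   1. *)

Require Import Defs.
From mathcomp Require Import all_boot all_order all_algebra.
From mathcomp Require Import fingroup morphism perm action.
From mathcomp Require Import boolp reals complex.
From mathcomp Require Import zify.

Set Implicit Arguments.
Unset Strict Implicit.
Unset Printing Implicit Defensive.
Import GRing.Theory.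

(** * Orbits of permutations *)

(* Cardinals that are convertible but not syntactically equal confuse [lia]. *)
Ltac card_lia := repeat (let n := fresh in move: (#|_|) => n); rewrite /=; lia.

Section PermutationOrbits.
Variable T : finType.
Implicit Types (s t : {perm T}) (S D : {set T}).
Local Open Scope group_scope.

Lemma porbit_invariant (A : Type) (f : T -> A) s x y :
  (forall z, f (s z) = f z) -> y \in porbit s x -> f y = f x.
Proof.
move=> fs /porbitP[i ->]; elim: i => [|i IH]; first by rewrite expg0 perm1.
by rewrite expgSr permM fs.
Qed.

Lemma porbits1 : #|porbits (1 : {perm T})| = #|T|.
Proof.
rewrite /porbits card_imset // => x y /eqP.
by rewrite eq_porbit_mem => /porbitP[i ->]; rewrite expg1n perm1.
Qed.

(** Composing with this transposition makes [t x] a fixed point and shortens its old cycle by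
    one. *)
Lemma porbits_tperm_fix t x : t x != x ->
  #|porbits (tperm x (t x) * t)| = #|porbits t|.+1.
Proof.
move=> tx; have /= := porbits_mul_tperm t x (t x).
rewrite eq_sym tx -(expg1 t) porbit_sym mem_porbit /=; lia.
Qed.

(* The Riemann-Hurwitz inequality: the number of values of [f] counts connected
   components, and the right-hand side minus the left-hand side is twice the
   total genus when [f] separates the orbits of the group generated by [t] and
   [s]. *)
Lemma porbits_mul_le t s : exists f : T -> {set T},
  [/\ forall x, f (t x) = f x, forall x, f (s x) = f x
    & #|porbits t| + #|porbits s| + #|porbits (t * s)| <= #|T| + #|f @: T|.*2].
Proof.
have [m] := ubnP (#|T| - #|porbits t|).
elim: m t => // m IH t Hm.
have [/forallP t1|] := boolP [forall x, t x == x].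
  have -> : t = 1 by apply/permP=> x; rewrite perm1; apply/eqP.
  exists (porbit s); split=> [x|x|]; first by rewrite perm1.
  - by rewrite -{2}(expg1 s) porbit_perm.
  - by rewrite mul1g porbits1 -/(porbits s); lia.
rewrite negb_forall => /existsP[x tx].
(* Cutting [t x] out of its cycle brings [t] closer to the identity, so the induction hypothesis
   applies to [t']. *)
have [t' [Et Ct']] :
    exists t', t = tperm x (t x) * t' /\ #|porbits t'| = #|porbits t|.+1.
  exists (tperm x (t x) * t); rewrite mulgA tperm2 mul1g.
  by rewrite porbits_tperm_fix.
have le_t' : #|porbits t'| <= #|T| by apply: leq_imset_card.
have [|f [ft fs Hf]] := IH t'; first lia.
have Hc : #|porbits (t * s)| + (t x \notin porbit (t' * s) x).*2
          = #|porbits (t' * s)|.+1.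
  have /= := porbits_mul_tperm (t' * s) x (t x).
  by rewrite porbit_sym mulgA -Et eq_sym tx addn1.
have [fx|fx] := eqVneq (f x) (f (t x)).
  exists f; split=> // [z|]; last by move: Hf Ct' Hc; case: (_ \notin _); card_lia.
  rewrite Et permM; case: tpermP => [->|->|_ _]; rewrite ft //.
(* Here [t] joins two components of [t'] and [s], so their labels are merged. Since [x] and [t x]
   lie in different cycles of [t' * s], the orbit counts of [t] and [t * s] both drop by one, which
   pays for the lost component. *)
pose f' z := if f z == f x then f (t x) else f z.
have nin : t x \notin porbit (t' * s) x.
  apply/negP=> /(porbit_invariant (f := f)) => E.
  by case/eqP: fx; rewrite E // => z; rewrite permM fs ft.
have f'x : f' x = f' (t x).
  by rewrite /f' eqxx [f (t x) == _]eq_sym (negPf fx).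
have tE z : t z = t' (tperm x (t x) z) by rewrite {1}Et permM.
exists f'; split=> [z|z|].
- have -> : f' (t z) = f' (tperm x (t x) z) by rewrite tE /f' ft.
  by case: tpermP => [->|->|].
- by rewrite /f' fs.
have : #|f @: T :\ f x| <= #|f' @: T|.
  apply/subset_leq_card/subsetP=> A; rewrite !inE => /andP[Ax /imsetP[z _ Az]].
  by apply/imsetP; exists z => //; rewrite /f' -Az (negPf Ax).
have := cardsD1 (f x) (f @: T); rewrite imset_f //.
rewrite nin in Hc; move: Hf Ct' Hc; card_lia.
Qed.

(* [s'] is the first return map of [s] on the complement of [D]. *)
Lemma first_return s D :
    (forall x, x \in D -> exists2 z, z \in porbit s x & z \notin D) ->
  exists s', [/\ forall x, x \in D -> s' x = x,
    forall x, s' x \in porbit s x,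
    forall x z, x \notin D -> z \notin D -> z \in porbit s x -> z \in porbit s' x,
    #|porbits s'| = #|porbits s| + #|D|
    & #|T| <= #|porbits (s' * s^-1)| + #|D|].
Proof.
have [m] := ubnP #|D|; elim: m D => // m IH D Hm HD.
have [->|[y yD]] := set_0Vmem D.
  exists s; split=> // [x|x||]; rewrite ?inE ?cards0 ?addn0 //.
  - by rewrite -{1}(expg1 s) mem_porbit.
  - by rewrite mulgV porbits1.
have cD := cardsD1 y D; rewrite yD /= in cD.
have [||s0 [fix0 orb0 conn0 card0 cut0]] := IH (D :\ y).
- lia.
- move=> x /setD1P[_ /HD[z zx zD]]; exists z => //.
  by rewrite !inE negb_and zD orbT.
pose w := s0^-1 y.
have s0w : s0 w = y by rewrite /w permKV.
(* Otherwise [s0] would fix [y], but [conn0] puts a point outside [D] on the [s0]-cycle of [y]. *)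
have wy : w != y.
  have [z zy zD] := HD y yD; apply/eqP=> w_y.
  have /(porbit_invariant (f := fun u => u == y)) E : z \in porbit s0 y.
    apply: conn0 => //; first by rewrite !inE eqxx.
    by rewrite !inE negb_and zD orbT.
  have/eqP zy' : (z == y).
    rewrite E ?eqxx // => u; apply/eqP/eqP => [|->]; rewrite -{1}s0w.
      by move/perm_inj->.
    by rewrite s0w -{1}w_y.
  by rewrite zy' yD in zD.
pose s' := tperm w y * s0.
have s'y : s' y = y by rewrite permM tpermR s0w.
have s'w : s' w = s0 y by rewrite permM tpermL.
have s'E x : x != w -> x != y -> s' x = s0 x.
  by move=> xw xy; rewrite permM tpermD // eq_sym.
have cs' : #|porbits s'| = #|porbits s0|.+1.
  by rewrite /s' -{1}s0w porbits_tperm_fix // s0w eq_sym.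
exists s'; split.
- move=> x xD; have [->|xy] := eqVneq x y; first exact: s'y.
  have xw : x != w.
    apply/eqP=> xw; have : s0 x = x by apply: fix0; rewrite !inE xy.
    by rewrite xw s0w => /eqP; rewrite eq_sym (negPf wy).
  by rewrite s'E // fix0 // !inE xy.
- move=> x; have [->|xy] := eqVneq x y; first by rewrite s'y porbit_id.
  have [->|xw] := eqVneq x w; last by rewrite s'E.
  have := orb0 w; rewrite s'w s0w => yw.
  have := orb0 y; rewrite -!eq_porbit_mem in yw * => /eqP->; exact: yw.
- move=> x z xD zD /(conn0 x z) /[!inE]; rewrite !negb_and xD zD !orbT.
  case/(_ isT isT)/porbitP => i Ez.
  have zy : z != y by apply: contraNneq zD => ->.
  have xy : x != y by apply: contraNneq xD => ->.
  rewrite {}Ez in zy *.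
  (* Induction on the length of the [s0]-path from [x]: a passage through [y] is replaced by the
     jump from [w] to [s0 y]. *)
  have [j] := ubnP i; elim: j => // j IHj in i zy {zD} *; case: i zy => [|i] zy ij.
    by rewrite expg0 perm1 porbit_id.
  have sub u : u \in porbit s' x -> s' u \in porbit s' x.
    by rewrite -!eq_porbit_mem -(porbit_perm s' 1 u) expg1.
  move: zy; rewrite expgSr permM => zy.
  have [iy|iy] := eqVneq ((s0 ^+ i) x) y; last first.
    rewrite -s'E //; first by apply/sub/IHj.
    by apply: contraNneq zy => ->; rewrite s0w.
  rewrite iy -s'w; apply: sub.
  case: i iy ij zy => [|i]; first by rewrite expg0 perm1 => /eqP; rewrite (negPf xy).
  rewrite expgSr permM -{1}s0w => /perm_inj iw ij _; rewrite -iw; apply: IHj; last lia.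
  by rewrite iw.
- by rewrite cs' card0 cD; lia.
(* [s'] differs from [s0] by one transposition, so each point of [D] costs the quotient by [s] at
   most one orbit. *)
- have := porbits_mul_tperm (s0 * s^-1) w y; rewrite /= mulgA -/s' wy.
  by move: cut0 cD; case: (_ \notin _); card_lia.
Qed.


(** * Orbits inside an invariant subset: counting and parity *)

Definition norbits s S := #|porbit s @: S|.

Lemma norbitsT s : norbits s setT = #|porbits s|.
Proof.
rewrite /norbits; congr #|pred_of_set _|; apply/setP=> O.
by apply/imsetP/imsetP=> -[x _ ->]; exists x.
Qed.

Lemma norbitsU s S S' : (forall x, (s x \in S) = (x \in S)) -> [disjoint S & S'] ->
  norbits s (S :|: S') = norbits s S + norbits s S'.
Proof.
move=> sS dS; rewrite /norbits imsetU cardsU -[RHS]subn0; congr (_ - _).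
apply/eqP; rewrite cards_eq0; apply/eqP/setP=> O; rewrite !inE.
apply/negP=> /andP[/imsetP[x xS ->] /imsetP[y yS' /eqP]].
rewrite eq_porbit_mem => /(porbit_invariant (f := fun z => z \in S) sS).
by rewrite xS (disjointFl dS yS').
Qed.

Lemma eq_norbits s t S : (forall x, (s x \in S) = (x \in S)) ->
  {in S, s =1 t} -> norbits s S = norbits t S.
Proof.
move=> sS st; have sti i x : x \in S -> (s ^+ i) x = (t ^+ i) x /\ (s ^+ i) x \in S.
  move=> xS; elim: i => [|i [IH iS]]; first by rewrite !expg0 perm1.
  by rewrite !expgSr !permM sS -IH st.
rewrite /norbits; congr #|pred_of_set _|; apply: eq_in_imset => x xS.
by apply/setP=> y; apply/porbitP/porbitP=> -[i ->]; exists i; case: (sti i x xS).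
Qed.

Lemma norbits1 S : norbits 1 S = #|S|.
Proof.
rewrite /norbits card_in_imset // => x y _ _ /eqP.
by rewrite eq_porbit_mem => /porbitP[i ->]; rewrite expg1n perm1.
Qed.

Lemma mem_astabs_perm s S :
  (forall x, (s x \in S) = (x \in S)) -> s \in 'N(S | 'P).
Proof. by move=> sS; apply/astabsP=> x; rewrite /= apermE. Qed.

(** Outside [S] the restriction is the identity, and there the fixed points cancel against their
    orbits in the sign formula. *)
Lemma odd_restr_perm s S : (forall x, (s x \in S) = (x \in S)) ->
  odd_perm (restr_perm S s) = odd (#|S| + norbits s S).
Proof.
move=> sS; have rE := restr_permE (mem_astabs_perm sS).
have rS x : (restr_perm S s x \in S) = (x \in S).
  by rewrite perm_closed ?restr_perm_on.
have rC x : x \in ~: S -> restr_perm S s x = (1 : {perm T}) x.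
  by rewrite perm1 inE; apply: out_perm; apply: restr_perm_on.
rewrite /odd_perm -norbitsT -(setUCr S) norbitsU // -?setI_eq0 ?setICr //.
rewrite (eq_norbits rS rE).
rewrite (@eq_norbits (restr_perm S s) 1 (~: S)) ?norbits1 //; last first.
  by move=> x; rewrite !inE rS.
rewrite -(cardsC S) !oddD.
by case: (odd _) (odd _) (odd _) => [] [] [].
Qed.

(** Multiplicativity of the sign. For the ribbon graph with edges [S] and vertex rotations [s] and
    [t], it says that chi and the number of boundary components have the same parity. *)
Lemma odd_norbitsM s t S :
    (forall x, (s x \in S) = (x \in S)) -> (forall x, (t x \in S) = (x \in S)) ->
  odd (#|S| + norbits s S + norbits t S + norbits (s * t) S) = false.
Proof.
move=> sS tS; have stS x : ((s * t) x \in S) = (x \in S) by rewrite permM tS sS.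
have : restr_perm S (s * t) = restr_perm S s * restr_perm S t.
  by apply: morphM; apply: mem_astabs_perm.
move/(congr1 (@odd_perm T)); rewrite odd_permM !odd_restr_perm // !oddD.
by case: (odd _) (odd _) (odd _) (odd _) => [] [] [] [].
Qed.

(** Partition [Y] by orbits: every orbit meeting [S] receives at least two points. *)
Lemma norbits_double s S (Y : {set T}) :
    (forall x, x \in S -> exists y z,
       [/\ y \in Y, z \in Y, y != z, y \in porbit s x & z \in porbit s x]) ->
  (norbits s S).*2 <= #|Y|.
Proof.
move=> HS; rewrite -[X in _ <= X]sum1_card (partition_big (porbit s) xpredT) //=.
rewrite (bigID (fun O => O \in porbit s @: S)) /= (leq_trans _ (leq_addr _ _)) //.
rewrite -muln2 /norbits -sum_nat_const; apply: leq_sum => O /imsetP[x xS ->].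
have [y [z [yY zY yz yx zx]]] := HS x xS.
rewrite sum1_card; apply: leq_trans (_ : #|[set y; z]| <= _).
  by rewrite cards2 yz.
apply/subset_leq_card/subsetP=> u; rewrite !inE -topredE /= eq_porbit_mem.
by case/orP=> /eqP->; apply/andP.
Qed.


(** * Ribbon graphs on a torus *)

Section Torus.
Variables (sigma tau : {perm T}) (Z : {set T}).
Let phi := sigma^-1 * tau^-1.
Hypothesis euler : #|porbits sigma| + #|porbits tau| + #|porbits phi| = #|T|.
Hypothesis Z_tau : forall x, exists2 z, z \in porbit tau x & z \in Z.
(** The complement of [Z] in the torus is connected: [f] labels faces, and [x] and [tau^-1 x] stand
    for the two faces next to the edge [x]. *)
Hypothesis connected : forall f : T -> {set T},
  (forall x, f (phi x) = f x) -> (forall x, x \notin Z -> f (tau^-1 x) = f x) ->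
  forall x y, f x = f y.

(* [S] is a union of components, each with at least two edges of [Z] at every
   vertex. *)
Definition cyclic_part (S : {set T}) :=
  [/\ forall x, (sigma x \in S) = (x \in S),
    forall x z, x \in Z -> z \in Z -> z \in porbit tau x -> (z \in S) = (x \in S),
    forall x, x \in S -> exists y z,
      [/\ y \in Z, z \in Z, y != z, y \in porbit sigma x & z \in porbit sigma x]
    & forall x, x \in Z -> x \in S -> exists z,
      [/\ z \in Z, z != x & z \in porbit tau x]].

(* The edges outside [Z] are detached from their black ends, but stay attached to
   their white ends, where they are pendant: [t] is the new black rotation and
   [t * sigma] the inverse of the new face permutation. *)
Lemma torus_cyclic_parts_meet S1 S2 :
    cyclic_part S1 -> cyclic_part S2 -> S1 != set0 -> S2 != set0 ->
    (forall x z, x \in Z -> z \in Z -> z \in porbit tau x ->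
       x \notin S1 :|: S2 -> z = x) ->
  ~~ [disjoint S1 & S2].
Proof.
move=> c1 c2 S1n0 S2n0 small; apply/negP=> dS.
have [x|t [tfix torb tconn tcard tcut]] := @first_return tau (~: Z).
  by have [z zx zZ] := Z_tau x; exists z => //; rewrite inE negbK.
have tZ x : (t x \in Z) = (x \in Z).
  apply/idP/idP => [|xZ].
    by apply: contraTT => xZ; rewrite tfix // inE.
  apply/negPn/negP=> txZ; have /perm_inj tx : t (t x) = t x by rewrite tfix // inE.
  by rewrite tx xZ in txZ.
have t_inv S : cyclic_part S -> forall x, (t x \in S) = (x \in S).
  case=> _ tS _ _ x; have [xZ|xZ] := boolP (x \in Z).
    by apply: tS => //; rewrite tZ.
  by rewrite tfix // inE.
(* With chi = norbits sigma S + norbits t S - #|S| and b boundary components, this says b >= chi +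
   2. Degrees at least 2 give chi <= 0; moreover b > 0 and b has the parity of chi. *)
have bound S : cyclic_part S -> S != set0 ->
    norbits sigma S + norbits t S + 2 <= norbits (t * sigma) S + #|S|.
  move=> cS Sn0; have tS := t_inv _ cS; case: cS => sS tauS big_s big_t.
  have Hs : (norbits sigma S).*2 <= #|S :&: Z|.
    apply: norbits_double => x xS; have [y [z [yZ zZ yz yx zx]]] := big_s x xS.
    exists y, z; rewrite !inE yZ zZ !andbT; split=> //.
      by rewrite (porbit_invariant (f := fun u => u \in S) sS yx).
    by rewrite (porbit_invariant (f := fun u => u \in S) sS zx).
  have HtZ : (norbits t (S :&: Z)).*2 <= #|S :&: Z|.
    apply: norbits_double => x /setIP[xS xZ]; have [z [zZ zx zt]] := big_t x xZ xS.
    exists z, x; rewrite !inE xS xZ zZ !andbT porbit_id; split=> //.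
      by rewrite (tauS x).
    by apply: tconn; rewrite ?inE ?negbK.
  have HtD : norbits t (S :\: Z) = #|S :\: Z|.
    rewrite -norbits1; apply: eq_norbits => x; rewrite !inE ?tS ?tZ //.
    by case/andP=> xZ _; rewrite perm1 tfix // inE.
  have Ht : norbits t S = norbits t (S :&: Z) + norbits t (S :\: Z).
    rewrite -{1}(setID S Z) norbitsU // => [x|]; first by rewrite !inE tS tZ.
    rewrite -setI_eq0; apply/eqP/setP=> x; rewrite !inE.
    by case: (x \in Z); rewrite ?andbF.
  have Hp : 0 < norbits (t * sigma) S.
    have [x xS] := set0Pn _ Sn0; apply/card_gt0P; exists (porbit (t * sigma) x).
    exact: imset_f.
  have := odd_norbitsM tS sS; have := cardsID Z S.
  move: Hs HtZ HtD Ht Hp.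
  move: #|S| #|S :&: Z| #|S :\: Z| (norbits sigma S) (norbits t S).
  by move: (norbits (t * sigma) S) (norbits t (S :&: Z)) (norbits t (S :\: Z)); lia.
have b1 := bound _ c1 S1n0; have b2 := bound _ c2 S2n0.
have [[t1 t2] [[s1 _ _ _] [s2 _ _ _]]] := ((t_inv _ c1, t_inv _ c2), (c1, c2)).
have tU x : (t x \in S1 :|: S2) = (x \in S1 :|: S2) by rewrite !inE t1 t2.
have sU x : (sigma x \in S1 :|: S2) = (x \in S1 :|: S2) by rewrite !inE s1 s2.
have split s : (forall x, (s x \in S1) = (x \in S1)) ->
    (forall x, (s x \in S2) = (x \in S2)) ->
  #|porbits s| = norbits s S1 + norbits s S2 + norbits s (~: (S1 :|: S2)).
  move=> sS1 sS2; rewrite -norbitsT -(setUCr (S1 :|: S2)) norbitsU ?norbitsU //.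
    by move=> x; rewrite !inE sS1 sS2.
  by rewrite -setI_eq0 setICr.
(* By [small], an edge of [Z] outside both parts is alone at its black end, so nothing is glued
   there and the rest contributes equally to both sides. *)
have t1' : {in ~: (S1 :|: S2), t =1 (1 : {perm T})}.
  move=> x; rewrite inE perm1 => xS; have [xZ|xZ] := boolP (x \in Z).
    by apply: (small x) => //; rewrite tZ.
  by rewrite tfix // inE.
have E3 : norbits t (~: (S1 :|: S2)) = #|~: (S1 :|: S2)|.
  rewrite -norbits1; apply: eq_norbits t1' => x; by rewrite 2!in_setC tU.
have F3 : norbits (t * sigma) (~: (S1 :|: S2)) = norbits sigma (~: (S1 :|: S2)).
  apply: eq_norbits => x; first by rewrite 2!in_setC permM sU tU.
  by move=> xS; rewrite permM t1' ?perm1.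
have /= Ts := split _ s1 s2; have /= Tt := split _ t1 t2.
have Tts : #|porbits (t * sigma)| = norbits (t * sigma) S1 + norbits (t * sigma) S2
    + norbits (t * sigma) (~: (S1 :|: S2)).
  by apply: split => x; rewrite permM ?s1 ?s2 ?t1 ?t2.
have cT : #|T| = #|S1| + #|S2| + #|~: (S1 :|: S2)|.
  by rewrite -(cardsC (S1 :|: S2)) cardsU (disjoint_setI0 dS) cards0 subn0.
(* [t * tau^-1] relates the two faces adjacent to each edge outside [Z]. *)
have [f [fC fphi]] := porbits_mul_le (t * tau^-1) (tau * sigma).
have -> : t * tau^-1 * (tau * sigma) = t * sigma by rewrite !mulgA mulgKV.
have -> : #|porbits (tau * sigma)| = #|porbits phi|.
  by rewrite -porbitsV invMg.
(* By connectedness there is a single component, so the three orbit counts add up to at most #|T| +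
   2. *)
have : #|f @: T| <= 1.
  apply/card_le1P => _ /imsetP[x _ ->] A; rewrite inE.
  apply/imsetP/eqP => [[y _ ->]|->].
    apply: connected => [z|z zZ].
      by rewrite -[in RHS](permKV (tau * sigma) z) fphi invMg.
    by rewrite -[RHS]fC permM tfix // inE.
  by exists x.
(* The bounds [b1] and [b2] each contribute 2; with [euler], [tcard] and [tcut] the same sum is at
   least #|T| + 4, a contradiction. *)
have := cardsC Z; move: euler b1 b2 E3 F3 Ts Tt Tts cT tcard tcut.
move: (norbits sigma _) (norbits sigma _) (norbits sigma _).
move: (norbits t _) (norbits t _) (norbits t _).
move: (norbits (t * sigma) _) (norbits (t * sigma) _) (norbits (t * sigma) _).
card_lia.
Qed.

End Torus.

End PermutationOrbits.

(** * The zero arrows of a representation *)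

Section Relations.
Local Open Scope ring_scope.
Variables (C : fieldType) (G : brane_tiling).
Implicit Types (x : rep1 C (dual_quiver G)) (a : edge G) (F : qface G).

Lemma big_seq_neq (I : eqType) (v : seq I) (i : I) (f : I -> C) : i \notin v ->
  \prod_(j <- v) f j = \prod_(j <- v | j != i) f j.
Proof.
move=> iv; rewrite big_seq [RHS]big_seq_cond; apply: eq_bigl => j.
by case: eqVneq => [->|_]; rewrite ?(negPf iv) ?andbT.
Qed.

(** Without repetitions only the position [index a u] contributes, and by commutativity its word
    evaluates to the product of the other letters. *)
Lemma sum_cyclic_deriv_word (Q : quiver) (x : rep1 C Q) (a : arrow Q) u :
  uniq u -> \sum_(v <- cyclic_deriv_word a u) \prod_(b <- v) x b =
            if a \in u then \prod_(b <- u | b != a) x b else 0.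
Proof.
move=> Uu; rewrite /cyclic_deriv_word; case: ifPn => [au|nau]; last first.
  rewrite (eq_in_filter (a2 := pred0)) ?filter_pred0 ?big_nil //.
  move=> i; rewrite mem_iota /= => iu; apply/eqP=> E.
  by move: nau; rewrite -E mem_nth.
rewrite (eq_in_filter (a2 := pred1 (index a u))) => [|i]; last first.
  rewrite mem_iota /= => iu; apply/eqP/eqP=> [<-|->]; last exact: nth_index.
  by rewrite index_uniq.
rewrite filter_pred1_uniq ?iota_uniq ?mem_iota ?index_mem //= big_seq1.
have Eu : u = take (index a u) u ++ a :: drop (index a u).+1 u.
  by rewrite -{1}(cat_take_drop (index a u) u) (drop_nth a) ?index_mem ?nth_index.
have := Uu; rewrite {1}Eu cat_uniq /= => /and3P[_ /norP[at_ _] /andP[ad _]].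
rewrite [in RHS]Eu !big_cat /= big_cons eqxx /= mulrC; congr (_ * _).
  by apply: big_seq_neq.
  by apply: big_seq_neq.
Qed.

Lemma mem_fconnect_porbit (T : finType) (s : {perm T}) (a b : T) :
  fconnect s a b = (b \in porbit s a).
Proof.
apply/idP/porbitP => [/iter_findex <-|[i ->]].
  by exists (findex s a b); rewrite permX.
by rewrite permX fconnect_iter.
Qed.

Lemma face_cycle_spec F :
  uniq (face_cycle F) /\ (forall b, (b \in face_cycle F) = on_qface F b).
Proof.
rewrite /face_cycle; case: pickP => [a aF|nF]; last by split=> // b; rewrite nF.
split; first exact: orbit_uniq.
move=> b; rewrite -fconnect_orbit mem_fconnect_porbit.
case: F aF => v /= /eqP <-; first by rewrite porbitV -rotwP eq_sym.
by rewrite -rotbP eq_sym.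
Qed.

(** Each arrow lies on exactly one white and one black face, so its relation is a difference of two
    cofactors. *)
Lemma eval_cyclic_deriv_potential x a :
  eval_rep1 x (cyclic_deriv (a : arrow (dual_quiver G)) (potential C G)) =
  \prod_(b | (wend b == wend a) && (b != a)) x b -
  \prod_(b | (bend b == bend a) && (b != a)) x b.
Proof.
have faceE F c :
    \sum_(cu <- [seq (c, v) |
                   v <- @cyclic_deriv_word (dual_quiver G) a (face_cycle F)])
    cu.1 * \prod_(b <- cu.2) x b =
    if on_qface F a then c * \prod_(b | on_qface F b && (b != a)) x b else 0.
  have [U memF] := face_cycle_spec F.
  rewrite big_map -big_distrr (@sum_cyclic_deriv_word (dual_quiver G)) //= memF.
  case: ifP; rewrite ?mulr0 // => _; congr (_ * _).
  rewrite -big_filter -[RHS]big_filter; apply: perm_big; apply: uniq_perm.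
  - exact: filter_uniq.
  - exact/filter_uniq/index_enum_uniq.
  by move=> b; rewrite !mem_filter memF mem_index_enum andbT andbC.
rewrite /eval_rep1 /cyclic_deriv big_flatten big_map /potential big_cat !big_map -!enumT.
rewrite (eq_bigr _ (fun v _ => faceE (inl v) 1)).
rewrite (eq_bigr _ (fun v _ => faceE (inr v) (-1))).
have sumE (T : finType) (v : T) (f : T -> C) :
    \sum_(i <- enum T) (if v == i then f i else 0) = f v.
  rewrite big_enum -big_mkcondr (big_pred1 v) // => i /=.
  by rewrite [RHS]eq_sym.
by rewrite /= !sumE mul1r mulN1r.
Qed.

End Relations.

(** * Vanishing face products and cycles of zero arrows *)

Section ZeroArrows.
Local Open Scope ring_scope.
Variables (C : fieldType) (G : brane_tiling).
Implicit Types (a b : edge G) (F : qface G).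

Definition face_prod (f : edge G -> C) F := \prod_(b | on_qface F b) f b.

Lemma qface_edge F : exists a, on_qface F a.
Proof.
case: F => v /=; first by have [a <-] := wend_surj v; exists a.
by have [a <-] := bend_surj v; exists a.
Qed.

Variable x : rep1 C (dual_quiver G).
Hypothesis hx : satisfies_relations (potential C G) x.

Lemma cofactors_eq a :
  \prod_(b | (wend b == wend a) && (b != a)) x b =
  \prod_(b | (bend b == bend a) && (b != a)) x b.
Proof. by apply/eqP; rewrite -subr_eq0 -eval_cyclic_deriv_potential; apply/eqP/hx. Qed.

Lemma face_prod_edge a : face_prod x (inl (wend a)) = face_prod x (inr (bend a)).
Proof.
by rewrite /face_prod (bigD1 a) //= cofactors_eq -bigD1 //= eqxx.
Qed.

(** The relation of an edge equates the products at its two ends, and the graph is connected. *)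
Lemma face_prod_const F F' : face_prod x F = face_prod x F'.
Proof.
suff white_const a b : face_prod x (inl (wend a)) = face_prod x (inl (wend b)).
  have qE K : exists a, face_prod x K = face_prod x (inl (wend a)).
    have [a aK] := qface_edge K; exists a; case: K aK => v /= /eqP <- //.
    by rewrite face_prod_edge.
  by have [[a ->] [b ->]] := (qE F, qE F').
have := edge_connected a b => /connectP[p]; elim: p a => [a _ -> //|c p IH a] /=.
case/andP=> ac cp lastb; rewrite -(IH c cp lastb).
by case/orP: ac => /eqP E; [rewrite E | rewrite !face_prod_edge E].
Qed.

Lemma qface_zero_arrow F : (exists a, x a = 0) -> exists2 a, x a = 0 & on_qface F a.
Proof.
case=> a xa; have : face_prod x F = 0.
  rewrite (face_prod_const F (inl (wend a))) /face_prod.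
  by rewrite (bigD1 a) //= xa mul0r.
by move/eqP/prodf_eq0 => [b bF /eqP xb]; exists b.
Qed.

(** Each side says that one cofactor of [a] vanishes, and the relation makes the cofactors equal. *)
Lemma zero_arrow_twin a :
  (exists b, [/\ x b = 0, b != a & wend b = wend a]) <->
  (exists b, [/\ x b = 0, b != a & bend b = bend a]).
Proof.
have twin (A : eqType) (f : edge G -> A) :
    (exists b, [/\ x b = 0, b != a & f b = f a]) <->
    \prod_(b | (f b == f a) && (b != a)) x b = 0.
  split=> [[b [xb ba fb]]|/eqP/prodf_eq0[b /andP[/eqP fb ba] /eqP xb]].
    by rewrite (bigD1 b) ?fb ?eqxx //= xb mul0r.
  by exists b.
by rewrite twin cofactors_eq -twin.
Qed.

Hypothesis ix : indecomposable x.

(** Nonzero arrows join only faces with equal labels, so [x] is the direct sum of its parts on the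
    faces labelled [f e0] and on the others; both would be nonzero if [f] took another value. *)
Lemma indecomposable_connected (f : edge G -> {set edge G}) :
    (forall e, f (face_perm (rotw G) (rotb G) e) = f e) ->
    (forall e, x e != 0 -> f ((rotb G)^-1%g e) = f e) ->
  forall e e0, f e = f e0.
Proof.
move=> f_face f_arrow e e0.
pose L (i : tface G) := [exists c in val i, f c == f e0].
have LE c : L (left_face c) = (f c == f e0).
  apply/exists_inP/idP => [[d /= dc /eqP <-]|fc]; last by exists c; rewrite ?porbit_id.
  by rewrite (porbit_invariant f_face dc).
pose U (l : bool) (i : tface G) : {vspace C^o} := if L i == l then fullv else 0%VS.
have subU (l : bool) : subrep (Q := dual_quiver G) x (U l).
  move=> a u; rewrite /U /= /right_face !LE.
  have [->|xa] := eqVneq (x a) 0; first by rewrite scale0r mem0v.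
  rewrite f_arrow //; case: ifP => _; first by rewrite !memvf.
  by rewrite memv0 => /eqP ->; rewrite scaler0 mem0v.
have full_neq0 : (fullv : {vspace C^o}) = 0%VS -> False.
  move=> E; have := memvf (1 : C^o); rewrite E memv0 => /eqP.
  by apply/eqP/oner_neq0.
have [_ /(_ (U true) (U false) (subU true) (subU false))] := ix.
case=> [i|/(_ (left_face e0))|/(_ (left_face e))].
- rewrite /U; case: (L i); rewrite /= ?add0v ?addv0 ?cap0v ?capv0 //.
- by rewrite /U LE eqxx /= => /full_neq0.
rewrite /U LE; case: (eqVneq (f e) (f e0)) => [//|_ /= E].
by case: (full_neq0 E).
Qed.

Lemma card_porbits_ends (A : finType) (f : edge G -> A) (s : {perm edge G}) :
    (forall a b, (f a == f b) = (b \in porbit s a)) ->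
    (forall v, exists a, f a = v) -> #|porbits s| = #|A|.
Proof.
move=> fP f_surj; rewrite -[RHS]cardsT.
have -> : porbits s = (fun v => [set b | f b == v]) @: [set: A].
  have sE a : porbit s a = [set b | f b == f a].
    by apply/setP=> b; rewrite inE eq_sym fP.
  apply/setP=> O; apply/imsetP/imsetP => [[a _ ->]|[v _ ->]].
    by exists (f a).
  by have [a <-] := f_surj v; exists a.
apply: card_imset => v w; have [a <-] := f_surj v => /setP/(_ a).
by rewrite !inE eqxx => /esym/eqP.
Qed.

(** Here [c] is any colouring that is constant on the components of the zero edges. Two colours on
    edges with a twin would give two disjoint nonempty cyclic parts of the torus. *)
Lemma zero_cycles_connected (c : edge G -> bool) :
    (exists a, x a = 0) ->
    (forall a b, x a = 0 -> x b = 0 -> wend a = wend b \/ bend a = bend b ->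
       c a = c b) ->
  forall a b, x a = 0 -> x b = 0 ->
    (exists a', [/\ x a' = 0, a' != a & wend a' = wend a]) ->
    (exists b', [/\ x b' = 0, b' != b & wend b' = wend b]) ->
  c a = c b.
Proof.
move=> x0 cP.
pose Z := [set a | x a == 0].
have ZE a : (a \in Z) = (x a == 0) by rewrite inE.
(* [big] marks the edges whose white end carries two zero edges; [lab] spreads the colour of the
   zero edges at a white vertex to all its edges. *)
pose big e :=
  [exists a in Z, exists b in Z, [&& a != b, wend a == wend e & wend b == wend e]].
pose lab e := [exists a in Z, (wend a == wend e) && c a].
have big_wend e e' : wend e = wend e' -> big e = big e' by rewrite /big => ->.
have lab_wend e e' : wend e = wend e' -> lab e = lab e' by rewrite /lab => ->.
have labE a : a \in Z -> lab a = c a.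
  rewrite ZE => /eqP xa; apply/exists_inP/idP => [[b]|ca].
    by rewrite ZE => /eqP xb /andP[/eqP ba]; rewrite (cP b a) //; left.
  by exists a; rewrite ?ZE ?xa ?eqxx.
have bigP a : a \in Z ->
    big a <-> exists b, [/\ x b = 0, b != a & wend b = wend a].
  move=> aZ; split=> [/exists_inP[b bZ /exists_inP[d dZ /and3P[bd /eqP wb /eqP wd]]]|].
    have [ba|ba] := eqVneq b a.
      by exists d; split; rewrite // -?ba 1?eq_sym //; apply/eqP; rewrite -ZE.
    by exists b; split; rewrite //; apply/eqP; rewrite -ZE.
  case=> b [xb ba wb]; apply/exists_inP; exists b; rewrite ?ZE ?xb //.
  by apply/exists_inP; exists a; rewrite // ba wb eqxx.
have big_bend a b : a \in Z -> b \in Z -> b != a -> bend b = bend a -> big a.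
  move=> aZ bZ ba E; apply/bigP/zero_arrow_twin => //.
  by exists b; split=> //; apply/eqP; rewrite -ZE.
have rotbE u v : v \in porbit (rotb G) u -> bend v = bend u.
  by rewrite -rotbP eq_sym => /eqP.
pose S (l : bool) := [set e | big e && (lab e == l)].
have cS l : cyclic_part (rotw G) (rotb G) Z (S l).
  split.
  - move=> e; have E : wend (rotw G e) = wend e.
      by apply/eqP; rewrite eq_sym rotwP (mem_porbit _ 1).
    by rewrite !inE (big_wend _ _ E) (lab_wend _ _ E).
  - move=> u v uZ vZ /rotbE E; have [->//|vu] := eqVneq v u.
    have uv : u != v by rewrite eq_sym.
    rewrite !in_set (big_bend u v uZ vZ vu E) (big_bend v u vZ uZ uv (esym E)) !labE //.
    have /eqP xu : x u == 0 by rewrite -ZE.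
    have /eqP xv : x v == 0 by rewrite -ZE.
    by rewrite (cP v u xv xu (or_intror E)).
  - move=> e; rewrite in_set => /andP[/exists_inP[u uZ /exists_inP[v vZ]]].
    case/and3P=> uv wu wv _; exists u, v; split=> //.
      by rewrite -rotwP eq_sym.
    by rewrite -rotwP eq_sym.
  - move=> u uZ; rewrite in_set => /andP[/(bigP u uZ)/zero_arrow_twin[v [xv vu E]] _].
    by exists v; split; rewrite ?ZE ?xv // -rotbP E.
move=> a b xa xb ha hb; apply/eqP/negPn/negP => cab.
have [aZ bZ] : a \in Z /\ b \in Z by rewrite !ZE xa xb.
have aS : a \in S (c a) by rewrite in_set labE // eqxx andbT; apply/bigP.
have bS : b \in S (~~ c a).
  rewrite in_set labE // (_ : c b = ~~ c a) ?eqxx ?andbT; first exact/bigP.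
  by case: (c a) (c b) cab => [] [].
suff : ~~ [disjoint S (c a) & S (~~ c a)].
  rewrite -setI_eq0 => /set0Pn[e]; rewrite !inE => /andP[/andP[_ /eqP ->]].
  by case: (c a); rewrite andbF.
apply: (@torus_cyclic_parts_meet _ (rotw G) (rotb G) Z) => //.
- rewrite (card_porbits_ends (@rotwP G) (@wend_surj G)).
  by rewrite (card_porbits_ends (@rotbP G) (@bend_surj G)) euler_torus.
- move=> e; have [u xu /eqP ue] := qface_zero_arrow (inr (bend e)) x0.
  by exists u; rewrite ?ZE ?xu // -rotbP ue.
- move=> f ff fZ; apply: indecomposable_connected => // e xe.
  by apply: fZ; rewrite ZE.
- by apply/set0Pn; exists a.
- by apply/set0Pn; exists b.
(* A zero edge with a twin at its black end is [big], hence in one of the two colour classes. *)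
move=> u v uZ vZ /rotbE E nS; apply/eqP/negPn/negP => vu; case/negP: nS.
by rewrite !in_set (big_bend u v) //=; case: (lab u); case: (c a).
Qed.

End ZeroArrows.

(** * Edge weights with prescribed products *)

Section PrescribedProducts.
Local Open Scope ring_scope.
Variables (C : fieldType) (G : brane_tiling) (Z : {set edge G}).
Implicit Types (a b : edge G) (F K : qface G) (t : edge G -> C) (h : qface G -> C).

(* The inverses at black vertices make the product over all vertices trivial. *)
Definition signed_prod t F :=
  \prod_(a | on_qface F a) (if F is inl _ then t a else (t a)^-1).

Definition attained h := exists t,
  [/\ forall a, t a != 0, forall a, a \notin Z -> t a = 1 &
      forall F, signed_prod t F = h F].

Lemma prod_qface (f : qface G -> C) :
  \prod_F f F = (\prod_v f (inl v)) * (\prod_v f (inr v)).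
Proof. by rewrite big_sumType. Qed.

Lemma prod_white_ends (f : edge G -> C) :
  \prod_v \prod_(a | wend a == v) f a = \prod_a f a.
Proof. by rewrite [RHS](partition_big (@wend G) xpredT). Qed.

Lemma prod_black_ends (f : edge G -> C) :
  \prod_v \prod_(a | bend a == v) f a = \prod_a f a.
Proof. by rewrite [RHS](partition_big (@bend G) xpredT). Qed.

Lemma prod_signed_prod t : (forall a, t a != 0) -> \prod_F signed_prod t F = 1.
Proof.
move=> t0; rewrite prod_qface /signed_prod /= prod_white_ends prod_black_ends.
by rewrite -big_split big1 //= => a _; rewrite divff.
Qed.

Lemma attained_ext h h' : h =1 h' -> attained h -> attained h'.
Proof. by move=> hh' [t [t0 tZ th]]; exists t; split=> // F; rewrite th. Qed.

Lemma attained1 : attained (fun=> 1).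
Proof.
exists (fun=> 1); split=> // [a|F]; first exact: oner_neq0.
by rewrite /signed_prod big1 // => a _; case: F; rewrite ?invr1.
Qed.

Lemma attainedM h h' : attained h -> attained h' -> attained (fun F => h F * h' F).
Proof.
move=> [t [t0 tZ th]] [t' [t0' tZ' th']]; exists (fun a => t a * t' a); split.
- by move=> a; rewrite mulf_neq0.
- by move=> a aZ; rewrite tZ // tZ' // mulr1.
move=> F; rewrite -th -th' /signed_prod -big_split /=; apply: eq_bigr => a _.
by case: F => _; rewrite ?invfM.
Qed.

Lemma attained_prod (I : finType) (P : pred I) (h : I -> qface G -> C) :
  (forall i, P i -> attained (h i)) -> attained (fun F => \prod_(i | P i) h i F).
Proof.
move=> Ph; elim: (index_enum I) => [|i s IH].
  by apply: attained_ext attained1 => F; rewrite big_nil.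
have [Pi|Pi] := boolP (P i).
  by apply: attained_ext (attainedM (Ph i Pi) IH) => F; rewrite big_cons Pi.
by apply: attained_ext IH => F; rewrite big_cons (negPf Pi).
Qed.

Definition spike F (c : C) K := if K == F then c else 1.

(** Weights on [Z] can transfer any factor from [F'] to [F] and leave all other signed products
    alone. *)
Definition linked F F' :=
  forall c : C, c != 0 -> attained (fun K => spike F c K * spike F' c^-1 K).

Lemma linked_sym F F' : linked F F' -> linked F' F.
Proof.
move=> l c c0; apply: attained_ext (l c^-1 _); last by rewrite invr_eq0.
by move=> K; rewrite invrK mulrC.
Qed.

Lemma linked_trans F F' F'' : linked F F' -> linked F' F'' -> linked F F''.
Proof.
move=> l l' c c0; apply: attained_ext (attainedM (l c c0) (l' c c0)) => K.
rewrite -!mulrA; congr (_ * _); rewrite mulrA -[RHS]mul1r; congr (_ * _).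
by rewrite /spike; case: eqP; rewrite ?mulr1 ?mulVf.
Qed.

(** Put weight [c] on [a] alone; the sign convention turns it into [c^-1] at the black end. *)
Lemma linked_edge a : a \in Z -> linked (inl (wend a)) (inr (bend a)).
Proof.
move=> aZ c c0; exists (fun b => if b == a then c else 1); split.
- by move=> b; case: ifP; rewrite ?oner_neq0.
- by move=> b bZ; case: eqP bZ => [->|//]; rewrite aZ.
move=> F; rewrite /signed_prod /spike.
have [aF|aF] := boolP (on_qface F a); last first.
  rewrite big1 => [|b bF]; last first.
    by case: (eqVneq b a) bF aF => [->->//|_ _ _]; case: F; rewrite ?invr1.
  case: F aF => v /= av.
    by rewrite (inj_eq inl_inj) eq_sym (negPf av) mulr1.
  by rewrite (inj_eq inr_inj) eq_sym (negPf av) mulr1.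
rewrite (bigD1 a) //= eqxx big1 => [|b /andP[_ /negPf ->]]; last first.
  by case: F {aF}; rewrite ?invr1.
by case: F aF => v /= /eqP <-; rewrite eqxx mulr1 ?mul1r.
Qed.

Hypothesis Z_edge : forall F, exists2 a, a \in Z & on_qface F a.
Let twin a := exists b, [/\ b \in Z, b != a & wend b = wend a].
Hypothesis twinP : forall a, a \in Z ->
  twin a <-> exists b, [/\ b \in Z, b != a & bend b = bend a].
Hypothesis twin_connected : forall c : edge G -> bool,
  (forall a b, a \in Z -> b \in Z -> wend a = wend b \/ bend a = bend b ->
     c a = c b) ->
  forall a b, a \in Z -> b \in Z -> twin a -> twin b -> c a = c b.

Lemma linked_twins a b : a \in Z -> b \in Z -> twin a -> twin b ->
  linked (inl (wend a)) (inl (wend b)).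
Proof.
move=> aZ bZ ta tb.
(* Being linked to the white end of [b] is constant along [Z], so it serves as the colouring. *)
pose c e := `[< linked (inl (wend e)) (inl (wend b)) >].
have := @twin_connected c _ a b aZ bZ ta tb; rewrite /c.
rewrite (asboolT (_ : linked (inl (wend b)) _)) => [/(_ _)/asboolP|]; last first.
  by apply: linked_trans (linked_edge bZ) (linked_sym (linked_edge bZ)).
apply=> u v uZ vZ uv; have luv : linked (inl (wend u)) (inl (wend v)).
  have lu := linked_edge uZ; case: uv => E; rewrite -?E.
    exact: linked_trans lu (linked_sym lu).
  by apply: linked_trans lu _; rewrite E; apply/linked_sym/linked_edge.
apply/asboolP/asboolP; last exact: linked_trans.
exact/linked_trans/linked_sym.
Qed.

(** Edges without a twin get their forced weights. The remaining vertices are all linked, so their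
    values can be gathered at one root, where their product is 1. *)
Lemma attained_prod1 h : (forall F, h F != 0) -> \prod_F h F = 1 ->
    (forall a, a \in Z -> ~ twin a -> h (inl (wend a)) * h (inr (bend a)) = 1) ->
  attained h.
Proof.
move=> h0 h1 h_single.
pose tw a := [exists b, [&& b \in Z, b != a & wend b == wend a]].
have twP a : reflect (twin a) (tw a).
  apply: (iffP existsP) => [[b /and3P[bZ ba /eqP E]]|[b [bZ ba E]]]; exists b => //.
  by rewrite bZ ba E /=.
pose t1 a := if (a \in Z) && ~~ tw a then h (inl (wend a)) else 1.
have t1_neq0 a : t1 a != 0 by rewrite /t1; case: ifP; rewrite ?oner_neq0.
have a1 : attained (signed_prod t1).
  by exists t1; split=> // a aZ; rewrite /t1 (negPf aZ).
(* A vertex that is not [bigF] has exactly one edge of [Z], and [h_single] makes its weight right at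
   both ends. *)
pose bigF F := [exists a in Z, on_qface F a && tw a].
have t1_big F : bigF F -> signed_prod t1 F = 1.
  case/exists_inP=> a aZ /andP[aF twa]; rewrite /signed_prod big1 // => b bF.
  suff -> : t1 b = 1 by case: F {aF bF}; rewrite ?invr1.
  rewrite /t1; case: ifP => // /andP[bZ /negP[]].
  case: (eqVneq a b) => [<- //|ab]; case: F aF bF => v /= /eqP av /eqP bv.
    by apply/twP; exists a; rewrite av bv.
  by apply/twP/twinP => //; exists a; rewrite av bv.
have t1_small F : ~~ bigF F -> signed_prod t1 F = h F.
  rewrite negb_exists_in => /forall_inP Fs; have [a aZ aF] := Z_edge F.
  have na : ~~ tw a by have := Fs a aZ; rewrite aF.
  rewrite /signed_prod (bigD1 a) //= big1 => [|b /andP[bF ba]]; last first.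
    suff -> : t1 b = 1 by case: F {aF bF Fs}; rewrite ?invr1.
    rewrite /t1; case: ifP => // /andP[bZ _]; case/twP: na.
    case: F aF bF {Fs} => v /= /eqP av /eqP bv; last apply/twinP => //.
      by exists b; rewrite av bv.
    by exists b; rewrite av bv.
  rewrite /t1 aZ na mulr1 /=; case: F aF {Fs} => v /= /eqP <- //.
  apply: (mulfI (h0 (inl (wend a)))).
  by rewrite (h_single a aZ (elimN (twP a) na)) divff.
(* The signed products of [t1] multiply to 1 and agree with [h] off the big vertices, so [h] has
   product 1 on the big ones. *)
have prod_big : \prod_(F | bigF F) h F = 1.
  have := prod_signed_prod t1_neq0; rewrite (bigID bigF) /= big1 // mul1r.
  rewrite (eq_bigr _ t1_small) => E.
  by have := h1; rewrite (bigID bigF) /= E mulr1.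
have [/existsP[a0 /andP[a0Z ta0]]|no_big] :=
  boolP [exists a, (a \in Z) && tw a]; last first.
  apply: attained_ext a1 => F; apply: t1_small; apply: contra no_big.
  by case/exists_inP=> a aZ /andP[_ ta]; apply/existsP; exists a; rewrite aZ.
pose r : qface G := inl (wend a0).
have link_r F : bigF F -> linked F r.
  case/exists_inP=> a aZ /andP[aF /twP ta].
  have lr := linked_twins aZ a0Z ta (twP _ ta0).
  case: F aF => v /= /eqP <- //.
  by apply: linked_trans lr; apply/linked_sym/linked_edge.
(* Each big [F] draws its value from the root [r]; the debts collected at [r] cancel by
   [prod_big]. *)
have := attained_prod (fun F bF => link_r F bF (h F) (h0 F)).
move/(attainedM a1); apply: attained_ext => K; rewrite big_split /=.
have -> : \prod_(F | bigF F) spike r (h F)^-1 K = 1.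
  rewrite /spike; case: eqP => _; last by rewrite big1.
  by rewrite prodfV prod_big invr1.
rewrite mulr1 /spike; have [bK|bK] := boolP (bigF K).
  rewrite t1_big // mul1r (bigD1 K) //= eqxx big1 ?mulr1 // => F /andP[_ FK].
  by rewrite eq_sym (negPf FK).
rewrite t1_small // big1 ?mulr1 // => F bF.
by case: eqP => // E; rewrite -E (negPf bK) in bF.
Qed.

End PrescribedProducts.

(** * Orbits of the torus *)

Section TorusOrbits.
Local Open Scope ring_scope.
Variables (C : fieldType) (G : brane_tiling).
Implicit Types (x y : rep1 C (dual_quiver G)).

(** The character of Z^{Q_1} with values [s] sends every [d2 F] to [c], hence all their differences
    to 1. *)
Lemma T_Lambda_extend (s : edge G -> C) (c : C) :
    (forall a, s a != 0) -> (forall F, face_prod s F = c) ->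
  exists2 t : {ffun edge G -> int} -> C,
    T_Lambda t & forall a, t (basis_vector a) = s a.
Proof.
move=> s0 sF; pose t (u : {ffun edge G -> int}) := \prod_a s a ^ u a.
have t0 u : t u != 0 by apply/prodf_neq0 => a _; rewrite expfz_neq0.
have tD u v : t (u + v) = t u * t v.
  by rewrite /t -big_split; apply: eq_bigr => a _; rewrite ffunE expfzDr.
have t_0 : t 0 = 1 by rewrite /t big1 // => a _; rewrite ffunE expr0z.
have tN u : t (- u) = (t u)^-1.
  by apply: (mulfI (t0 u)); rewrite -tD subrr t_0 divff.
have tM u (n : int) : t u = 1 -> t (u *~ n) = 1.
  move=> tu; have tn k : t (u *+ k) = 1.
    by elim: k => [|k IH]; rewrite ?mulr0n // mulrS tD IH tu mulr1.
  by case: n => k; rewrite ?NegzE ?mulrNz -pmulrn ?tN tn ?invr1.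
have tS (I : finType) (P : pred I) (f : I -> {ffun edge G -> int}) :
    t (\sum_(i | P i) f i) = \prod_(i | P i) t (f i).
  exact: (big_morph t tD t_0).
have tb a : t (basis_vector a) = s a.
  rewrite /t (bigD1 a) //= big1 => [|b /negPf ba]; rewrite ffunE ?ba ?expr0z //.
  by rewrite eqxx mulr1 expr1z.
exists t => //; split=> // u v [k uv].
have : t (u - v) = 1.
  rewrite uv tS big1 // => F _; rewrite tS big1 // => F' _; apply: tM.
  rewrite tD tN /d2 !tS !(eq_bigr _ (fun a _ => tb a)) -!/(face_prod s _) !sF.
  by rewrite divff // -(sF F); apply/prodf_neq0.
by rewrite tD tN => /(congr1 (fun w => w * t v)); rewrite mulfVK // mul1r.
Qed.

Lemma rep_support_torus_act x t : T_Lambda t ->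
  rep_support (torus_act t x) = rep_support x.
Proof.
case=> t0 _ _; apply/setP=> a; rewrite !inE ffunE.
by rewrite mulf_eq0 (negPf (t0 _)).
Qed.

Lemma same_orbit_of_face_prod x y (s : edge G -> C) (c : C) :
    (forall a, s a != 0) -> (forall F, face_prod s F = c) ->
    (forall a, y a = s a * x a) ->
  same_T_Lambda_orbit x y.
Proof.
move=> s0 sF yE; have [t tL tb] := T_Lambda_extend s0 sF.
by exists t; split=> //; apply/ffunP=> a; rewrite ffunE tb yE.
Qed.

Lemma same_support_orbit x y :
    satisfies_relations (potential C G) x ->
    satisfies_relations (potential C G) y ->
    indecomposable x ->
    rep_support x = rep_support y ->
  same_T_Lambda_orbit x y.
Proof.
move=> hx hy ix sxy.
have y0 a : (y a == 0) = (x a == 0).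
  by have /setP/(_ a) := sxy; rewrite !inE => /negb_inj.
(* On zero arrows the value 1 is a placeholder, corrected later by [t]. *)
pose z a := if x a == 0 then 1 else y a / x a.
have z0 a : z a != 0.
  by rewrite /z; case: ifPn => [_|xa]; rewrite ?oner_neq0 // mulf_neq0 ?invr_eq0 ?y0.
have yE a : y a = z a * x a.
  rewrite /z; case: eqP => [xa|/eqP xa]; last by rewrite divfK.
  by rewrite xa mulr0; apply/eqP; rewrite y0 xa.
have [/existsP[a1 /eqP xa1]|nz] := boolP [exists a, x a == 0]; last first.
  have xn a : x a != 0 by move: nz; rewrite negb_exists => /forallP/(_ a).
  have [a0] := card_gt0P (edge_neq0 G); move=> _.
  pose F0 : qface G := inl (wend a0).
  apply: (@same_orbit_of_face_prod x y z (face_prod y F0 / face_prod x F0)) => // F.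
  rewrite -(face_prod_const hx F) -(face_prod_const hy F) /face_prod.
  by rewrite -prodf_div; apply: eq_bigr => a _; rewrite /z (negPf (xn a)).
have x_zero : exists a, x a = 0 by exists a1.
pose Z := [set a | x a == 0].
have ZE a : a \in Z -> x a = 0 by rewrite inE => /eqP.
have EZ a : x a = 0 -> a \in Z by rewrite inE => ->.
(* This is the signed product that [t] needs for [t * z] to have all face products 1. *)
pose h (F : qface G) := if F is inl _ then (face_prod z F)^-1 else face_prod z F.
have fz0 F : face_prod z F != 0 by apply/prodf_neq0.
have [t [t0 tZ th]] : attained Z h.
  have twE (A : eqType) (f : edge G -> A) a :
      (exists b, [/\ b \in Z, b != a & f b = f a]) <->
      (exists b, [/\ x b = 0, b != a & f b = f a]).
    by split=> [[b [/ZE xb ba fb]]|[b [/EZ bZ ba fb]]]; exists b.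
  apply: attained_prod1.
  - by move=> F; have [a /EZ aZ aF] := qface_zero_arrow hx F x_zero; exists a.
  - by move=> a aZ; rewrite !twE; apply: zero_arrow_twin.
  - move=> c cP a b aZ bZ /twE ta /twE tb.
    apply: (zero_cycles_connected hx ix x_zero) ta tb; rewrite ?ZE // => u v xu xv.
    by apply: cP; apply: EZ.
  - by move=> F; rewrite /h; case: F => v; rewrite ?invr_eq0.
  (* Each [z a] occurs once at its white end, inverted, and once at its black end. *)
  - rewrite prod_qface /h /= prodfV [X in X^-1]prod_white_ends.
    by rewrite [X in _ * X]prod_black_ends mulVf //; apply/prodf_neq0.
  move=> a aZ nta; have xa := ZE a aZ.
  have za : z a = 1 by rewrite /z xa eqxx.
  have nta' : ~ exists b, [/\ x b = 0, b != a & bend b = bend a].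
    by rewrite -(zero_arrow_twin hx a) -twE.
  rewrite /h /face_prod (bigD1 a) //= [X in _ * X](bigD1 a) //= za !mul1r.
  (* With no other zero edge at the vertex, the cofactor of [z] is the quotient of those of [y] and
     [x], which the relations make equal at both ends. *)
  have zE (A : eqType) (f : edge G -> A) :
      ~ (exists b, [/\ x b = 0, b != a & f b = f a]) ->
      \prod_(b | (f b == f a) && (b != a)) z b =
      (\prod_(b | (f b == f a) && (b != a)) y b) /
      (\prod_(b | (f b == f a) && (b != a)) x b).
    move=> nf; rewrite -prodf_div; apply: eq_bigr => b /andP[/eqP fb ba].
    by rewrite /z; case: eqP => // xb; case: nf; exists b.
  have nta2 : ~ exists b, [/\ x b = 0, b != a & wend b = wend a] by rewrite -twE.
  rewrite (zE _ _ nta2) (cofactors_eq hx) (cofactors_eq hy) -(zE _ _ nta') mulVf //.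
  exact/prodf_neq0.
(* [t] is 1 on the support and [x] vanishes on [Z], so the corrected weights still carry [x] to
   [y]. *)
apply: (@same_orbit_of_face_prod x y (fun a => t a * z a) 1).
- by move=> a; rewrite mulf_neq0.
- move=> F; rewrite /face_prod big_split /=.
  have := th F; rewrite /signed_prod /h; case: F => v tF.
    by rewrite tF mulVf.
  by apply: invr_inj; rewrite invfM -prodfV tF -/(face_prod z _) divff ?invr1.
move=> a; rewrite yE; have [aZ|/tZ ->] := boolP (a \in Z); last by rewrite mul1r.
by rewrite ZE // !mulr0.
Qed.

End TorusOrbits.

Local Open Scope complex_scope.

Theorem proposition4p12 (R : realType) (G : brane_tiling)
    (hG : geometrically_consistent R G)
    (x y : rep1 R[i] (dual_quiver G))
    (hx : satisfies_relations (potential R[i] G) x)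
    (hy : satisfies_relations (potential R[i] G) y)
    (ix : indecomposable x) (iy : indecomposable y) :
  same_T_Lambda_orbit x y <-> rep_support x = rep_support y.
Proof.
split=> [[t [tL ->]]|]; last exact: same_support_orbit.
by rewrite rep_support_torus_act.
Qed.
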